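(* The field of real numbers $\mathbb R$ is Euclidean, and $\mathbb R(\sqrt{-1})=\mathbb C$ is algebraically closed.
   Context: A field $\mathcal F$ is formally real if $-1$ is not a (finite) sum of squares in $\mathcal F$. Write $\mathcal F^\times=\mathcal F\setminus\{0\}$ and let $\mathcal F^{\times 2}$ be the set of squares of elements of $\mathcal F^\times$. A field $\mathcal F$ is Euclidean if it is formally real and $\mathcal F^\times=\mathcal F^{\times 2}\cup(-\mathcal F^{\times 2})$; equivalently, it is an ordered field in which every non-negative element is a square. $\mathbb R(\sqrt{-1})$ denotes the field obtained from $\mathbb R$ by adjoining a square root of $-1$, i.e. the field of complex numbers $\mathbb C$. *)

(* Defs.v *)
From mathcomp Require Import all_boot all_algebra.
From mathcomp Require Import boolp classical_sets.
From mathcomp Require Export Rstruct.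
From mathcomp Require Export complex.

Set Implicit Arguments.
Unset Strict Implicit.
Unset Printing Implicit Defensive.

Import GRing.Theory.
Local Open Scope classical_set_scope.
Local Open Scope ring_scope.

Definition formally_real (F : fieldType) : Prop :=
  ~ exists s : seq F, -1 = \sum_(x <- s) x ^+ 2.

Definition nonzeros (F : fieldType) : set F := [set x | x != 0].
Arguments nonzeros F : clear implicits.

Definition nonzero_squares (F : fieldType) : set F :=
  [set x ^+ 2 | x in nonzeros F].
Arguments nonzero_squares F : clear implicits.

Definition euclidean_field (F : fieldType) : Prop :=
  formally_real F /\
  nonzeros F =
    nonzero_squares F `|` [set - x | x in nonzero_squares F].

(* L, seen as an extension of F through iota, is F(i) with i ^+ 2 = -1: the
   only subfield of L containing the image of F and i is L itself. *)
Definition adjoins_sqrtN1 (F L : fieldType) (iota : {rmorphism F -> L})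
    (i : L) : Prop :=
  i ^+ 2 = -1 /\
  forall K : {pred L}, GRing.divring_closed K ->
    (forall x : F, iota x \in K) -> i \in K -> forall z : L, z \in K.

(* Main.v *)
Require Import Defs.
From mathcomp Require Import all_boot all_order all_algebra.
From mathcomp Require Import classical_sets.

(** All three parts hold over every real closed field [F], and the real numbers
    are one.  Squares in [F] are non-negative while [-1] is negative, so [-1] is
    not a sum of squares; and of [x] and [- x] one is non-negative, hence a
    square, since non-negative elements have square roots
    ([rcf_euclidean_field]).  The elements [a + i b] are already produced from
    [F] and [i] by ring operations ([complex_adjoins_sqrtN1]).  That [F[i]] is
    algebraically closed is the fundamental theorem of algebra, whose algebraic
    form needs only that positive elements have square roots and that odd-degree
    polynomials have roots in [F]
    ([complex_acf_axiom]). *)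

Import Order.TTheory GRing.Theory Num.Theory.
Local Open Scope ring_scope.

Lemma realField_formally_real (F : realFieldType) : formally_real F.
Proof.
move=> [s sumE].
have : 0 <= \sum_(x <- s) x ^+ 2 by apply: sumr_ge0 => x _; exact: sqr_ge0.
by rewrite -sumE oppr_ge0 ler10.
Qed.

Lemma rcf_nonzero_square (F : rcfType) (x : F) :
  0 < x -> nonzero_squares F x.
Proof.
move=> x_gt0; exists (Num.sqrt x); last by rewrite sqr_sqrtr // ltW.
by rewrite /nonzeros /= gt_eqF // sqrtr_gt0.
Qed.

Lemma rcf_euclidean_field (F : rcfType) : euclidean_field F.
Proof.
split; first exact: realField_formally_real.
apply/seteqP; split => [x /= x_neq0|x /=].
  have [x_gt0|x_lt0|x_eq0] := ltgtP 0 x.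
  - by left; apply: rcf_nonzero_square.
  - right; exists (- x); last exact: opprK.
    by apply: rcf_nonzero_square; rewrite oppr_gt0.
  - by rewrite /nonzeros /= -x_eq0 eqxx in x_neq0.
rewrite /nonzeros /=.
by case=> [[y y_neq0 <-]|[_ [y y_neq0 <-] <-]]; rewrite ?oppr_eq0 expf_neq0.
Qed.

Lemma complex_adjoins_sqrtN1 (F : rcfType) :
  adjoins_sqrtN1 (real_complex F) ('i%C : F[i]).
Proof.
split=> [|K K_closed FK iK z]; first exact: sqr_i.
have [_ KD] : GRing.addr_closed K.
  exact: GRing.zmod_closedD (GRing.divring_closedBM K_closed).
have [_ KM] : GRing.mulr_closed K.
  exact: GRing.divr_closedM (GRing.divring_closed_div K_closed).
by rewrite (complexE z) KD ?KM ?FK ?iK.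
Qed.

Theorem corollary4p3 :
  euclidean_field Rdefinitions.R /\
  adjoins_sqrtN1 (real_complex Rdefinitions.R) ('i%C : Rdefinitions.R[i]) /\
  GRing.closed_field_axiom Rdefinitions.R[i].
Proof.
split; first exact: rcf_euclidean_field.
by split; [exact: complex_adjoins_sqrtN1 | exact: complex_acf_axiom].
Qed.
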